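(* Let $P=\{1324\}$. For $n\ge2$ and integer $l$, let $c_{n,l}$ be the number of $l$-clusters relative to $P$ whose permutation has length $n$ (with $c_{n,l}=0$ for $l\le0$), and set $c_{1,l}=\delta_{0,l}$. Then $c_{2,l}=c_{3,l}=0$ for all $l$, and for all $n\ge4$ and all $l$, $$c_{n,l}=\sum_{k\ge1,\ 2k+2\le n}\frac{1}{k+1}\binom{2k}{k}\,c_{n-2k-1,\,l-k}.$$ Consequently, if $\pi_{n,k}$ is the number of permutations of length $n$ with exactly $k$ occurrences of $1324$ and $\Pi(x,t)=\sum_{n,k}\pi_{n,k}\frac{x^n}{n!}t^k$, then $$\Pi(x,t)=\Big(1-x-\sum_{n\ge2,\,l\ge1}\frac{c_{n,l}\,x^n(t-1)^l}{n!}\Big)^{-1}.$$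
   Context: A permutation of length $n$ is a sequence containing each of $1,\dots,n$ exactly once. For a sequence $s$ of distinct integers, $\mathrm{st}(s)$ is the unique permutation with the same relative order of entries. An occurrence of a pattern $\pi$ in $\sigma$ is a consecutive segment $\sigma_i\cdots\sigma_j$ with $\mathrm{st}(\sigma_i\cdots\sigma_j)=\pi$. For a set $P$ of patterns, a $q$-cluster ($q\ge1$) is a tuple $(\sigma,\pi_1,\dots,\pi_q,i_1,\dots,i_q)$ with $\sigma$ a permutation of length $n$, $\pi_k\in P$ of length $r_k$, such that $\mathrm{st}(\sigma_{i_k}\cdots\sigma_{i_k+r_k-1})=\pi_k$ for all $k$, $i_k<i_{k+1}<i_k+r_k$ for $k<q$, $i_1=1$ and $n=i_q+r_q-1$. $\delta$ is the Kronecker delta. *)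

(* Defs.v *)
From mathcomp Require Import all_boot all_order all_fingroup all_algebra.

Set Implicit Arguments.
Unset Strict Implicit.
Unset Printing Implicit Defensive.

Import GRing.Theory.

Local Open Scope nat_scope.

(* Patterns, and permutations viewed as words, are one-line notations: *)
(* sequences listing each of 1, ..., n once. *)
Definition word (n : nat) (s : 'S_n) : seq nat :=
  [seq (s i : nat).+1 | i <- enum 'I_n].

(* Each entry is replaced by its rank; see st_perm, st_homo and st_unique. *)
Definition st (s : seq nat) : seq nat :=
  [seq (count (fun y => y < x) s).+1 | x <- s].

(* Positions are numbered from 1.  A window running past the end of w is *)
(* truncated by take, hence too short to have standardization p. *)
Definition occurs_at (p w : seq nat) (i : nat) : bool :=
  (0 < i) && (st (take (size p) (drop i.-1 w)) == p).

Definition nb_occ (p w : seq nat) : nat :=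
  count (occurs_at p w) (iota 1 (size w)).

Definition is_cluster (w : seq nat) (ps : seq (seq nat)) (js : seq nat) : bool :=
  let q := size js in
  let i k := nth 0 js k in
  let p k := nth [::] ps k in
  [&& 0 < q,
      size ps == q,
      [forall k : 'I_q, occurs_at (p k) w (i k)],
      [forall k : 'I_q, (k.+1 < q) ==> (i k < i k.+1 < i k + size (p k))],
      i 0 == 1
    & size w == i q.-1 + size (p q.-1) - 1].

(* seq_sub P is the finite type of the patterns belonging to P; the bound *)
(* 'I_n.+1 holds all positions 1, ..., n. *)
Definition nb_clusters (P : seq (seq nat)) (n q : nat) : nat :=
  #|[set x : 'S_n * q.-tuple (seq_sub P) * q.-tuple 'I_n.+1 |
      is_cluster (word x.1.1) [seq val p | p <- x.1.2]
                 [seq nat_of_ord i | i <- x.2]]|.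

Definition p1324 : seq nat := [:: 1; 3; 2; 4].

Definition c (n : nat) (l : int) : nat :=
  if n == 1 then nat_of_bool (l == 0%R)
  else if l is Posz q.+1 then nb_clusters [:: p1324] n q.+1 else 0.

Definition nb_perm_occ (n k : nat) : nat :=
  #|[set s : 'S_n | nb_occ p1324 (word s) == k]|.

Local Open Scope ring_scope.

(* Formal power series in x over A; f n is the coefficient of x^n. *)
Definition fps (A : Type) : Type := nat -> A.

Definition fps_one (A : nzRingType) : fps A := fun n => (n == 0%N)%:R.

Definition fps_X (A : nzRingType) : fps A := fun n => (n == 1%N)%:R.

Definition fps_sub (A : nzRingType) (f g : fps A) : fps A := fun n => f n - g n.

Definition fps_mul (A : nzRingType) (f g : fps A) : fps A :=
  fun n => \sum_(i < n.+1) f i * g (n - i)%N.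

Definition fps_is_inverse (A : comNzRingType) (g f : fps A) : Prop :=
  fps_mul f g =1 fps_one A.

(* The series below live in Q[t][[x]], with t the variable 'X of {poly rat}. *)
(* Bounding k and l by n loses nothing: see nb_perm_occ_eq0 and c_eq0. *)
Definition Pi_series : fps {poly rat} := fun n =>
  \sum_(0 <= k < n.+1) ((nb_perm_occ n k)%:R / n`!%:R) *: 'X^k.

Definition cluster_series : fps {poly rat} := fun n =>
  if (2 <= n)%N then
    \sum_(1 <= l < n.+1) ((c n l%:Z)%:R / n`!%:R) *: ('X - 1) ^+ l
  else 0.

Local Open Scope nat_scope.

Lemma st_homo (s : seq nat) (i j : nat) : i < size s -> j < size s ->
  (nth 0 (st s) i < nth 0 (st s) j) = (nth 0 s i < nth 0 s j).
Proof.
move=> si sj; rewrite /st !(nth_map 0) // ltnS.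
set x := nth 0 s i; set y := nth 0 s j.
case: (ltnP x y) => [xy|yx]; last first.
  by apply/negbTE; rewrite -leqNgt; apply: sub_count => z /= /leq_trans; apply.
have xs : x \in s by rewrite mem_nth.
have := count_predUI (fun z => z < x) (pred1 x) s.
rewrite (@eq_count _ (predI _ _) pred0) => [|z /=]; last first.
  by case: eqP => [->|]; rewrite ?ltnn ?andbF.
rewrite count_pred0 addn0 => e.
have h : 0 < count (pred1 x) s by rewrite -has_count has_pred1.
apply: (@leq_trans (count (predU (fun z => z < x) (pred1 x)) s)).
  by rewrite e -addn1 leq_add2l.
by apply: sub_count => z /= /orP[/ltn_trans->//|/eqP->].
Qed.

Lemma st_perm (s : seq nat) : uniq s -> perm_eq (st s) (iota 1 (size s)).
Proof.
move=> us.
have ust : uniq (st s).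
  apply/(uniqP 0) => i j; rewrite !inE size_map => si sj e.
  have e1 := st_homo si sj; have e2 := st_homo sj si.
  rewrite e ltnn in e1; rewrite e ltnn in e2.
  apply/eqP; rewrite -(nth_uniq 0 si sj us) eqn_leq.
  by case: ltngtP e1 e2.
apply: uniq_perm (iota_uniq _ _) _ => //.
apply: (uniq_min_size ust _ _).2; last by rewrite size_iota size_map.
move=> z /mapP[x xs ->]; rewrite mem_iota /= add1n ltnS.
rewrite -[X in _ < X](count_predC (fun y => y < x)) -[X in X < _]addn0 ltn_add2l.
by rewrite -has_count; apply/hasP; exists x => //=; rewrite ltnn.
Qed.

Lemma st_unique (s t : seq nat) : size t = size s ->
  perm_eq t (iota 1 (size t)) ->
  (forall i j, i < size s -> j < size s ->
     (nth 0 t i < nth 0 t j) = (nth 0 s i < nth 0 s j)) ->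
  t = st s.
Proof.
move=> sz pt H; apply: (@eq_from_nth _ 0) => [|i]; first by rewrite size_map.
rewrite sz => si; rewrite /st (nth_map 0) //.
have -> : count (fun y => y < nth 0 s i) s = count (fun y => y < nth 0 t i) t.
  have E (u : seq nat) x : count (fun y => y < x) u =
      count (fun k => nth 0 u k < x) (iota 0 (size u)).
    by rewrite -[X in count _ X = _](mkseq_nth 0 u) count_map.
  rewrite !E sz; apply: eq_in_count => j; rewrite mem_iota /= add0n => sj.
  by rewrite H.
rewrite (seq.permP pt).
have : nth 0 t i \in iota 1 (size t) by rewrite -(perm_mem pt) mem_nth ?sz.
rewrite mem_iota; case: (nth 0 t i) => // x /= hx.
have -> : size t = x + (size t - x) by rewrite subnKC // -ltnS -add1n ltnW.
rewrite iotaD count_cat (@eq_in_count _ _ predT) => [|z]; last first.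
  by rewrite mem_iota => /andP[_]; rewrite add1n => ->.
rewrite count_predT size_iota (@eq_in_count _ _ pred0) ?count_pred0 ?addn0 // => z.
by rewrite mem_iota add1n => /andP[h _]; rewrite ltnNge h.
Qed.

Lemma size_word (n : nat) (s : 'S_n) : size (word s) = n.
Proof. by rewrite size_map -cardE card_ord. Qed.

Lemma nb_perm_occ_eq0 (n k : nat) : n < k -> nb_perm_occ n k = 0.
Proof.
move=> nk; apply/eqP; rewrite cards_eq0; apply/eqP/setP => s; rewrite !inE.
apply/negbTE; rewrite neq_ltn; apply/orP; left; apply: leq_ltn_trans nk.
by rewrite -[X in _ <= X](size_word s) -[X in _ <= X](size_iota 1) count_size.
Qed.

Lemma c_eq0 (n l : nat) : n < l -> c n l%:Z = 0.
Proof.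
case: l => // q nq; rewrite /c; case: eqP => // _.
apply/eqP; rewrite cards_eq0; apply/eqP/setP => -[[s p] j]; rewrite !inE /=.
apply/negbTE/negP => /and5P[_ _ _ /forallP inc /andP[/eqP i1 _]].
rewrite size_map size_tuple in inc.
have H k : k < q.+1 -> k < nth 0 [seq nat_of_ord i | i <- j] k.
  elim: k => [|k IH] hk; first by rewrite i1.
  have := inc (Ordinal (ltnW hk)); rewrite /= hk => /andP[h _].
  exact: leq_ltn_trans (IH (ltnW hk)) h.
have := H q (ltnSn q); rewrite (nth_map ord0) ?size_tuple //.
move=> h; have := leq_trans h (leq_ord _).
by move/(leq_trans nq); rewrite ltnn.
Qed.

(* Main.v *)
Require Import Defs.
From mathcomp Require Import all_boot all_order all_fingroup all_algebra.
From mathcomp Require Import zify ring.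

(** Two occurrences of 1324 that overlap are shifted by 2 or 3.  A maximal
    initial run of [k] marked occurrences shifted by 2 covers [2k + 2] entries;
    its last entry is its maximum, and also the minimum of the rest of the
    cluster.  The first [2k + 1] entries are thus the smallest ones, and their
    arrangements are the linear extensions of a two-row poset, counted by the
    Catalan number: removing the maximum gives the ballot recursion.

    For the generating function, write t = 1 + (t - 1) at each occurrence, so
    that t^occ sums (t - 1)^marks over all sets of marked occurrences, and split
    off the cluster (or single entry) containing the first position.  This is an
    identity on words, in which prefix and suffix matter only up to order
    isomorphism; summing it over permutations yields the binomial convolution
    that is the product of exponential generating functions. *)

Set Implicit Arguments.
Unset Strict Implicit.
Unset Printing Implicit Defensive.

Import GRing.Theory Num.Theory.

(** * Splitting permutations *)

Definition order_iso (s t : seq nat) : Prop :=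
  size s = size t /\
  forall i j, i < size s -> j < size s ->
    (nth 0 s i < nth 0 s j) = (nth 0 t i < nth 0 t j).

Lemma order_iso_drop d s t : order_iso s t -> order_iso (drop d s) (drop d t).
Proof.
move=> [sz H]; split; first by rewrite !size_drop sz.
by move=> i j; rewrite !size_drop => hi hj; rewrite !nth_drop H //; lia.
Qed.

Lemma nth_word n (s : 'S_n) (i : 'I_n) : nth 0 (word s) i = (s i).+1.
Proof. by rewrite (nth_map i) ?nth_ord_enum // size_enum_ord. Qed.

Lemma word_inj_nth n (s : 'S_n) i j : i < n -> j < n ->
  nth 0 (word s) i = nth 0 (word s) j -> i = j.
Proof.
move=> hi hj; rewrite (nth_word s (Ordinal hi)) (nth_word s (Ordinal hj)).
by case=> /val_inj/perm_inj/(congr1 val).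
Qed.

Section Glue.
Variables m p : nat.

(** A permutation of length m + p amounts to the set of values on its first m positions together
    with the patterns of its two halves. *)
Definition gluing : Type :=
  ({B : {set 'I_(m + p)} | #|B| == m} * ('S_m * 'S_p))%type.

Implicit Types x : gluing.

Definition glue_fun x (i : 'I_(m + p)) : 'I_(m + p) :=
  match split i with
  | inl j => nth i (enum (val x.1)) (x.2.1 j)
  | inr j => nth i (enum (~: val x.1)) (x.2.2 j)
  end.

Lemma card_gluing x : (#|val x.1| = m) * (#|~: val x.1| = p).
Proof.
have /eqP e := valP x.1; split=> //.
by have := cardsC (val x.1); rewrite e card_ord => /addnI.
Qed.

Lemma glue_fun_mem x i : (glue_fun x i \in val x.1) = (i < m).
Proof.
rewrite /glue_fun; case: splitP => j _.
  by rewrite -mem_enum mem_nth // -cardE card_gluing.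
have : nth i (enum (~: val x.1)) (x.2.2 j) \in ~: val x.1.
  by rewrite -mem_enum mem_nth // -cardE card_gluing.
by rewrite inE => /negbTE.
Qed.

Lemma glue_fun_inj x : injective (glue_fun x).
Proof.
move=> i j e; have := glue_fun_mem x i; rewrite e glue_fun_mem.
move: e; rewrite /glue_fun.
case: splitP => i' ei; case: splitP => j' ej e //.
  move=> _; apply: ord_inj; rewrite ei ej.
  rewrite (set_nth_default i) in e; last by rewrite -cardE card_gluing.
  move/eqP: e; rewrite nth_uniq ?enum_uniq // -?cardE ?card_gluing //.
  by move/eqP/ord_inj/perm_inj->.
move=> _; apply: ord_inj; rewrite ei ej.
rewrite (set_nth_default i) in e; last by rewrite -cardE card_gluing.
move/eqP: e; rewrite nth_uniq ?enum_uniq // -?cardE ?card_gluing //.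
by move/eqP/ord_inj/perm_inj->.
Qed.

Definition glue x : 'S_(m + p) := perm (@glue_fun_inj x).

(** [enum] lists a set of ordinals increasingly, so choosing elements by rank preserves order. The
    two defaults differ because [glue_fun] uses the position itself as default. *)
Lemma ltn_nth_enum n (B : {set 'I_n}) y z i j : i < #|B| -> j < #|B| ->
  (nth y (enum B) i < nth z (enum B) j) = (i < j).
Proof.
move=> hi hj; rewrite (set_nth_default y z) -?cardE //.
have sB : sorted ltn (map val (enum B)).
  rewrite {1}/enum_mem -enumT /= filter_mask map_mask val_enum_ord.
  exact: (sorted_mask ltn_trans) (iota_ltn_sorted _ _).
have e k : k < #|B| -> val (nth y (enum B) k) = nth 0 (map val (enum B)) k.
  by move=> hk; rewrite (nth_map y) // -cardE.
rewrite !e //; have szB : size (map val (enum B)) = #|B| by rewrite size_map -cardE.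
have H := sorted_ltn_nth ltn_trans 0 sB.
case: (ltngtP i j) => [ij|ji|->]; last by rewrite ltnn.
  by apply: H; rewrite ?inE ?szB.
by apply/negbTE; rewrite -leqNgt ltnW //; apply: H; rewrite ?inE ?szB.
Qed.

Lemma glue_lshift x (i : 'I_m) :
  glue x (lshift p i) = nth (lshift p i) (enum (val x.1)) (x.2.1 i).
Proof. by rewrite permE /glue_fun (unsplitK (inl i)). Qed.

Lemma glue_rshift x (i : 'I_p) :
  glue x (rshift m i) = nth (rshift m i) (enum (~: val x.1)) (x.2.2 i).
Proof. by rewrite permE /glue_fun (unsplitK (inr i)). Qed.

Lemma take_glue x : order_iso (take m (word (glue x))) (word x.2.1).
Proof.
have sz : size (take m (word (glue x))) = m.
  by rewrite size_takel // size_word leq_addr.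
split=> [|i j]; rewrite sz ?size_word // => hi hj; rewrite !nth_take //.
rewrite (nth_word (glue x) (lshift p (Ordinal hi))).
rewrite (nth_word (glue x) (lshift p (Ordinal hj))).
rewrite (nth_word x.2.1 (Ordinal hi)) (nth_word x.2.1 (Ordinal hj)) !glue_lshift.
by rewrite ltnS ltn_nth_enum ?card_gluing.
Qed.

Lemma drop_glue x : order_iso (drop m (word (glue x))) (word x.2.2).
Proof.
have sz : size (drop m (word (glue x))) = p.
  by rewrite size_drop size_word addKn.
split=> [|i j]; rewrite sz ?size_word // => hi hj; rewrite !nth_drop.
rewrite (nth_word (glue x) (rshift m (Ordinal hi))).
rewrite (nth_word (glue x) (rshift m (Ordinal hj))).
rewrite (nth_word x.2.2 (Ordinal hi)) (nth_word x.2.2 (Ordinal hj)) !glue_rshift.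
by rewrite ltnS ltn_nth_enum ?card_gluing.
Qed.

Lemma glue_inj : injective glue.
Proof.
move=> x y e.
have eB : x.1 = y.1.
  apply: val_inj; apply/setP => v.
  have [i ->] : exists i, v = glue x i by exists ((glue x)^-1%g v); rewrite permKV.
  by rewrite {2}e !permE !glue_fun_mem.
have e1 : x.2.1 = y.2.1.
  apply/permP => i; have /permP/(_ (lshift p i)) := e; rewrite !glue_lshift eB.
  move/eqP; rewrite nth_uniq ?enum_uniq // -?cardE ?card_gluing //.
  by move/eqP/ord_inj.
have e2 : x.2.2 = y.2.2.
  apply/permP => i; have /permP/(_ (rshift m i)) := e; rewrite !glue_rshift eB.
  move/eqP; rewrite nth_uniq ?enum_uniq // -?cardE ?card_gluing //.
  by move/eqP/ord_inj.
by case: x y eB e1 e2 {e} => [B [a b]] [B' [a' b']] /= -> -> ->.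
Qed.

Lemma card_subsets : #|{: {B : {set 'I_(m + p)} | #|B| == m}}| = 'C(m + p, m).
Proof. by rewrite card_sig -[in RHS](card_ord (m + p)) -card_draws cardsE. Qed.

(** Injectivity suffices, since 'C(m + p, m) * (m! * p!) = (m + p)!. *)
Lemma glue_bij : bijective glue.
Proof.
apply: inj_card_bij glue_inj _.
rewrite !card_prod card_subsets !card_Sn.
by have := bin_fact (leq_addr p m); rewrite addKn => ->.
Qed.

Lemma card_lt : #|[set i : 'I_(m + p) | i < m]| = m.
Proof.
rewrite -[RHS]card_ord -(card_imset _ (@lshift_inj m p)).
apply: eq_card => i; rewrite inE; apply/idP/imsetP => [hi|[j _ ->]] /=.
  by exists (Ordinal hi) => //; apply: ord_inj.
exact: ltn_ord.
Qed.

Lemma glue_below x :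
  allrel ltn (take m (word (glue x))) (drop m (word (glue x))) =
  (val x.1 == [set i : 'I_(m + p) | i < m]).
Proof.
set w := word _; have sw : size w = m + p by rewrite size_word.
have nw (i : 'I_(m + p)) : nth 0 w i = (glue x i).+1 by rewrite nth_word.
apply/idP/eqP => [/allrelP H|H].
  have lt b v : b \in val x.1 -> v \notin val x.1 -> b < v.
    have [i ->] : exists i, b = glue x i by exists ((glue x)^-1%g b); rewrite permKV.
    have [j ->] : exists j, v = glue x j by exists ((glue x)^-1%g v); rewrite permKV.
    rewrite ![glue x _ in X in X -> _]permE ![glue x _ in X in _ -> X -> _]permE.
    rewrite !glue_fun_mem => hi hj; rewrite -ltnS -!nw; apply: H.
      by rewrite -(nth_take 0 hi) mem_nth // size_takel // sw leq_addr.
    have hm : m <= j by rewrite leqNgt.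
    rewrite -(subnKC hm) -nth_drop mem_nth // size_drop sw.
    by have := ltn_ord j; lia.
  apply/eqP; rewrite eqEcard card_lt card_gluing leqnn andbT.
  apply/subsetP => b hb; rewrite inE ltnNge; apply/negP => mb.
  (* An element of the value set that is at least m would force every value below m into the set
     too, giving it more than m elements. *)
  have : [set i : 'I_(m + p) | i < m] \proper val x.1.
    apply/properP; split; last by exists b; rewrite // inE ltnNge mb.
    apply/subsetP => i; rewrite inE => im; apply/negPn/negP => /(lt _ _ hb).
    by lia.
  by move/proper_card; rewrite card_lt card_gluing ltnn.
apply/allrelP => a b /(nthP 0)[i]; rewrite size_takel ?sw ?leq_addr // => hi.
rewrite nth_take // => <- /(nthP 0)[j]; rewrite size_drop sw addKn => hj.
rewrite nth_drop => <-.
rewrite (nw (lshift p (Ordinal hi))) (nw (rshift m (Ordinal hj))).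
have h1 := glue_fun_mem x (lshift p (Ordinal hi)).
have h2 := glue_fun_mem x (rshift m (Ordinal hj)).
rewrite H inE /= hi in h1; rewrite H inE /= in h2.
by rewrite !permE /=; lia.
Qed.

End Glue.

Definition iso_invariant (T : Type) (F : seq nat -> T) : Prop :=
  forall s t, order_iso s t -> F s = F t.

(** After reindexing by [glue] the summand depends only on the two patterns; the value set
    contributes just its number of choices. *)
Lemma sum_split_perm (A : comNzRingType) m p (F G : seq nat -> A) :
  iso_invariant F -> iso_invariant G ->
  (\sum_(s : 'S_(m + p)) F (take m (word s)) * G (drop m (word s)) =
   'C(m + p, m)%:R *
     ((\sum_(s : 'S_m) F (word s)) * (\sum_(s : 'S_p) G (word s))))%R.
Proof.
move=> invF invG; rewrite (reindex _ (onW_bij _ (glue_bij m p))) /=.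
under eq_bigr => x _ do
  rewrite (invF _ _ (take_glue x)) (invG _ _ (drop_glue x)).
rewrite -(pair_bigA _ (fun _ (x : 'S_m * 'S_p) => F (word x.1) * G (word x.2)))%R /=.
rewrite sumr_const card_subsets mulr_natl; congr (_ *+ _)%R.
rewrite -(pair_bigA _ (fun x y => F (word x) * G (word y)))%R.
by rewrite big_distrlr.
Qed.

(** Same reindexing, but by [glue_below] a single value set survives, so no binomial appears. *)
Lemma sum_below_split_perm m p (F G : seq nat -> nat) :
  iso_invariant F -> iso_invariant G ->
  \sum_(s : 'S_(m + p)) allrel ltn (take m (word s)) (drop m (word s)) *
      (F (take m (word s)) * G (drop m (word s))) =
  (\sum_(s : 'S_m) F (word s)) * (\sum_(s : 'S_p) G (word s)).
Proof.
move=> invF invG; rewrite (reindex _ (onW_bij _ (glue_bij m p))) /=.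
under eq_bigr => x _ do
  rewrite (invF _ _ (take_glue x)) (invG _ _ (drop_glue x)) glue_below.
rewrite -(pair_bigA _ (fun (B : {B : {set 'I_(m + p)} | #|B| == m})
   (x : 'S_m * 'S_p) => (val B == [set i : 'I_(m + p) | i < m]) *
    (F (word x.1) * G (word x.2)))) /=.
have h : #|[set i : 'I_(m + p) | i < m]| == m by rewrite card_lt.
pose B0 : {B : {set 'I_(m + p)} | #|B| == m} :=
  exist _ [set i : 'I_(m + p) | i < m] h.
rewrite (bigD1 B0) //= eqxx [X in _ + X]big1 ?addn0; last first.
  move=> B; rewrite -val_eqE /= => /negbTE->.
  by rewrite big1.
under eq_bigr => x _ do rewrite mul1n.
by rewrite -(pair_bigA _ (fun x y => F (word x) * G (word y))) big_distrlr.
Qed.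

(** * Linear extensions of two-row posets *)

Definition extends (R : rel nat) (w : seq nat) : bool :=
  [forall i : 'I_(size w), forall j : 'I_(size w),
     R i j ==> (nth 0 w i < nth 0 w j)].

Lemma extendsP (R : rel nat) w :
  reflect (forall i j, i < size w -> j < size w -> R i j ->
             nth 0 w i < nth 0 w j)
          (extends R w).
Proof.
apply: (iffP forallP) => [H i j hi hj|H i].
  by have /forallP/(_ (Ordinal hj))/implyP := H (Ordinal hi).
by apply/forallP => j; apply/implyP; apply: H.
Qed.

Lemma extends_invariant R : iso_invariant (extends R).
Proof.
move=> s t [sz H]; apply/extendsP/extendsP => E i j.
  by rewrite -sz => hi hj r; rewrite -H //; apply: E.
by move=> hi hj r; rewrite H //; apply: E; rewrite -?sz.
Qed.

Definition nb_ext (n : nat) (R : rel nat) : nat :=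
  \sum_(s : 'S_n) extends R (word s).

Lemma eq_nb_ext n (R1 R2 : rel nat) :
  (forall i j, i < n -> j < n -> R1 i j = R2 i j) -> nb_ext n R1 = nb_ext n R2.
Proof.
move=> e; apply: eq_bigr => s _; congr nat_of_bool.
by apply/extendsP/extendsP => E i j hi hj r; apply: E => //;
  rewrite size_word in hi hj; rewrite ?e // -e.
Qed.

(** Relabelling positions by the bijection [f] amounts to composing every permutation with it. *)
Lemma nb_ext_reindex n (R : rel nat) (f : nat -> nat) :
  (forall i, i < n -> f i < n) ->
  (forall i j, i < n -> j < n -> f i = f j -> i = j) ->
  nb_ext n (fun i j => R (f i) (f j)) = nb_ext n R.
Proof.
move=> fn finj; pose g (i : 'I_n) := Ordinal (fn i (ltn_ord i)).
have ginj : injective g.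
  by move=> i j /(congr1 val) /= /finj e; apply: ord_inj; apply: e.
rewrite /nb_ext (reindex_inj (mulgI (perm ginj))) /=.
apply: eq_bigr => s _; congr nat_of_bool.
have nw (i : 'I_n) : nth 0 (word (perm ginj * s)) i = nth 0 (word s) (g i).
  by rewrite !nth_word permM permE.
apply/extendsP/extendsP => E i j; rewrite size_word => hi hj r.
  have [i' ei] : exists i', perm ginj i' = Ordinal hi.
    by exists ((perm ginj)^-1%g (Ordinal hi)); rewrite permKV.
  have [j' ej] : exists j', perm ginj j' = Ordinal hj.
    by exists ((perm ginj)^-1%g (Ordinal hj)); rewrite permKV.
  rewrite permE in ei; rewrite permE in ej.
  have := E i' j'; rewrite !nw ei ej size_word => /(_ (ltn_ord _) (ltn_ord _)).
  by apply; rewrite -[f i']/(val (g i')) -[f j']/(val (g j')) ei ej.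
by rewrite (nw (Ordinal hi)) (nw (Ordinal hj)); apply: E; rewrite ?size_word ?fn.
Qed.

Definition add_max (n : nat) (R : rel nat) : rel nat :=
  fun i j => if j == n then i < n else [&& i < n, j < n & R i j].

Lemma extends_add_max n R w : size w = n.+1 ->
  extends (add_max n R) w =
  allrel ltn (take n w) (drop n w) && extends R (take n w).
Proof.
move=> sw; have st : size (take n w) = n by rewrite size_takel // sw.
have dw : drop n w = [:: nth 0 w n] by rewrite (drop_nth 0) ?sw // drop_oversize ?sw.
rewrite dw; apply/extendsP/andP => [E|[/allrelP A /extendsP E] i j].
  split.
    apply/allrelP => x y /(nthP 0)[i]; rewrite st => hi; rewrite nth_take // => <-.
    rewrite inE => /eqP->; apply: E; rewrite ?sw //; first exact: ltnW.
    by rewrite /add_max eqxx.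
  apply/extendsP => i j; rewrite st => hi hj r; rewrite !nth_take //.
  by apply: E; rewrite ?sw ?ltnS 1?ltnW // /add_max hi hj r ltn_eqF.
rewrite sw /add_max => hi hj; case: eqP => [-> hin|_ /and3P[hi' hj' r]].
  apply: A; last by rewrite inE.
  by rewrite -(nth_take 0 hin) mem_nth // st.
by have := E i j; rewrite st !nth_take //; apply.
Qed.

(** The last entry must be the maximum: split it off as a second block of length 1 lying above the
    first. *)
Lemma nb_ext_add_max n R : nb_ext n.+1 (add_max n R) = nb_ext n R.
Proof.
have := sum_below_split_perm n 1 (F := fun w => extends R w) (G := fun=> 1).
rewrite /nb_ext addn1 sum1_card card_Sn muln1 => <- //; last first.
  by move=> s t /extends_invariant->.
apply: eq_bigr => s _; rewrite extends_add_max ?size_word // muln1.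
by case: allrel; case: extends.
Qed.

(* Positions below [a] carry the first row of a two-row array, the others *)
(* the second row; entry [i.+1] of the first row lies below entry [i] of the *)
(* second. *)
Definition two_rows (a : nat) : rel nat :=
  fun i j => if i < a then (if j < a then i < j else i <= j - a + 1)
             else i < j.

Lemma nb_two_rows_step1 a : nb_ext a.+1 (two_rows a.+1) = nb_ext a (two_rows a).
Proof.
rewrite -[RHS]nb_ext_add_max; apply: eq_nb_ext => i j hi hj.
rewrite /two_rows /add_max hi hj; case: eqP => [->|ne]; first by lia.
have -> : j < a by lia.
by case: (ltnP i a) => //=; lia.
Qed.

(** Ballot recursion for rows of lengths a and b + 1: the maximum ends one of the two rows, and is
    deleted. It can end the first row only if b + 2 < a, since otherwise that entry lies below one
    of the second row. *)
Lemma nb_two_rows_step a b : b.+1 < a ->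
  nb_ext (a + b).+1 (two_rows a) =
  nb_ext (a + b) (two_rows a) +
  (b.+2 < a) * nb_ext (a + b) (two_rows a.-1).
Proof.
move=> ba.
(* [g] sends the end of the first row to the last position and closes the gap, which brings that
   case into the form [add_max]. *)
pose g i := if i == a.-1 then a + b else if i < a then i else i.-1.
have g_lt i : i < (a + b).+1 -> g i < (a + b).+1.
  by move=> hi; rewrite /g; do 2?case: ifP; lia.
have g_inj i j : i < (a + b).+1 -> j < (a + b).+1 -> g i = g j -> i = j.
  by move=> hi hj; rewrite /g; do 4?case: ifP; lia.
rewrite -!(nb_ext_add_max (a + b)) -(nb_ext_reindex (add_max _ (two_rows a.-1)) g_lt g_inj).
rewrite /nb_ext big_distrr -big_split; apply: eq_bigr => s _ /=.
set w := word s; have sw : size w = (a + b).+1 by rewrite size_word.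
have : nth 0 w a.-1 != nth 0 w (a + b).
  by apply/eqP => /word_inj_nth; lia.
(* The larger of the two row ends is the maximum, so exactly one of the two summands can be
   nonzero. *)
rewrite neq_ltn => /orP[lt|lt].
  have -> : extends (fun i j => add_max (a + b) (two_rows a.-1) (g i) (g j)) w = false.
    apply/negP => /extendsP/(_ (a + b) a.-1); rewrite sw.
    have -> : g a.-1 = a + b by rewrite /g eqxx.
    by rewrite /add_max eqxx /g; do 2?case: ifP; lia.
  rewrite muln0 addn0; congr nat_of_bool.
  apply/extendsP/extendsP => E i j; rewrite sw => hi hj; rewrite /add_max.
    case: eqP => [-> hia|ne /and3P[_ _ r]]; last by apply: E; rewrite ?sw.
    case: (ltnP i a.-1) => hi1.
      apply: ltn_trans lt; apply: E; rewrite ?sw; try lia.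
      by rewrite /two_rows; do 3?case: ifP; lia.
    case: (eqVneq i a.-1) => [->//|ne].
    by apply: E; rewrite ?sw // /two_rows; do 3?case: ifP; lia.
  move=> r; apply: E; rewrite ?sw // /add_max.
  move: (r); rewrite /two_rows; do 3?case: ifP; lia.
have -> : extends (add_max (a + b) (two_rows a)) w = false.
  apply/negP => /extendsP/(_ a.-1 (a + b)); rewrite sw /add_max eqxx; lia.
rewrite add0n; case: ltnP => ba2; last first.
  rewrite mul0n; apply/eqP; rewrite eqb0; apply/negP.
  move=> /extendsP/(_ a.-1 (a + b)); rewrite sw /two_rows.
  do 2?case: ifP; lia.
rewrite mul1n; congr nat_of_bool.
apply/extendsP/extendsP => E i j; rewrite sw => hi hj; last first.
  move=> r; apply: E; rewrite ?sw //; move: r; rewrite /add_max /two_rows /g.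
  by case: (eqVneq i a.-1); case: (eqVneq j a.-1); repeat case: ifP; lia.
rewrite /add_max; case: eqP => [gj|gj].
  have -> : j = a.-1 by move: gj; rewrite /g; do 2?case: ifP; lia.
  move=> gi; case: (ltnP i a) => hia.
    apply: E; rewrite ?sw; try lia.
    by move: gi; rewrite /g /two_rows; do 3?case: ifP; lia.
  case: (eqVneq i (a + b)) => [->//|ne].
  apply: ltn_trans lt; apply: E; rewrite ?sw //; try lia.
  by rewrite /two_rows; do 2?case: ifP; lia.
move=> /and3P[_ _ r]; apply: E; rewrite ?sw //.
move: r gj; rewrite /two_rows /g.
by case: (eqVneq i a.-1); case: (eqVneq j a.-1); repeat case: ifP; lia.
Qed.

(** Ballot numbers: when the values are read in increasing order, the first row stays strictly ahead
    of the second. The factor a keeps the formula in [nat]. *)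
Lemma nb_two_rows a b : b < a ->
  a * nb_ext (a + b) (two_rows a) = (a - b) * 'C(a.-1 + b, b).
Proof.
have [n le_n] := ubnP (a + b); elim: n a b le_n => // n IH a [|b] le_n ba.
  rewrite bin0 muln1 subn0 addn0; suff -> : nb_ext a (two_rows a) = 1 by rewrite muln1.
  elim: a {ba le_n} => [|a <-]; last exact: nb_two_rows_step1.
  rewrite /nb_ext (eq_bigr (fun=> 1)) ?sum1_card ?card_Sn // => s _.
  by apply/eqP; rewrite eqb1; apply/extendsP => i j; rewrite size_word.
rewrite addnS nb_two_rows_step // mulnDr IH; [|lia|lia].
case: a ba le_n => // a ba le_n /=.
have pascal : 'C(a + b.+1, b.+1) = 'C(a + b, b.+1) + 'C(a + b, b).
  by rewrite addnS binS.
have absorb : b.+1 * 'C(a + b, b.+1) = a * 'C(a + b, b).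
  by rewrite mul_bin_left; congr (_ * _); lia.
rewrite pascal; case: ltnP => ba2; last first.
  (* Boundary case: the second term of the recursion is absent, and [absorb] makes the two binomials
     of [pascal] equal. *)
  have eb : a = b.+1 by lia.
  rewrite mul0n muln0 addn0 {1}eb.
  move: absorb; rewrite eb => /eqP; rewrite eqn_pmul2l // => /eqP->.
  by rewrite [in RHS]subSS; nia.
have IHa := IH a b.+1; rewrite -addSnnS in IHa.
have {}IHa := IHa _ _.
rewrite mul1n; have := IHa ltac:(lia) ltac:(lia).
case: a ba2 {IH ba le_n pascal IHa} absorb => // a ba2 absorb.
have -> : a.+1.-1 + b.+1 = a.+1 + b by lia.
move: absorb; set X := 'C(_, b); set Y := 'C(_, b.+1); set L := nb_ext _ _.
have [d ->] : exists d, a = b.+1 + d by exists (a - b.+1); lia.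
nia.
Qed.

(** * Marked occurrences of 1324 *)

Definition starts1324 (w : seq nat) : bool :=
  [&& 3 < size w, nth 0 w 0 < nth 0 w 2, nth 0 w 2 < nth 0 w 1
    & nth 0 w 1 < nth 0 w 3].

Lemma starts1324_invariant : iso_invariant starts1324.
Proof.
move=> s t [sz H]; rewrite /starts1324 -sz; case: ltnP => //= h.
by rewrite !H //; lia.
Qed.

Lemma st_take4 w : (st (take 4 w) == p1324) = starts1324 w.
Proof.
case: (ltnP 3 (size w)) => [|sw]; last first.
  rewrite /starts1324 ltnNge sw /=; apply/eqP => /(congr1 size) /=.
  by rewrite size_map size_take; case: ifP; lia.
case: w => [|a [|b [|c0 [|d w]]]] // _.
rewrite /starts1324 [take _ _]/= take0 /=.
apply/eqP/idP => [e|/and3P[h1 h2 h3]].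
  have H i j : i < 4 -> j < 4 ->
      (nth 0 p1324 i < nth 0 p1324 j) = (nth 0 [:: a; b; c0; d] i < nth 0 [:: a; b; c0; d] j).
    by move=> hi hj; rewrite -e st_homo.
  by rewrite -(H 0 2) // -(H 2 1) // -(H 1 3).
by symmetry; apply: st_unique => // -[|[|[|[|i]]]] [|[|[|[|j]]]] //= _ _; lia.
Qed.

Lemma occurs_at1324 w i : occurs_at p1324 w i.+1 = starts1324 (drop i w).
Proof. by rewrite /occurs_at /= st_take4. Qed.

(** The second step of 1324 is a descent, while an occurrence begins with an ascent. *)
Lemma starts1324_drop1 w : starts1324 w -> starts1324 (drop 1 w) = false.
Proof.
rewrite /starts1324 => /and4P[_ _ h _].
by rewrite !nth_drop !add1n; apply/negP => /and4P[]; lia.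
Qed.

(* Overlapping occurrences of 1324 are shifted by 2 or 3.  The convention for *)
(* [q = 0] agrees with [c 1 l]. *)
Fixpoint nb_marks (q : nat) (w : seq nat) : nat :=
  if q is q'.+1 then
    starts1324 w * (nb_marks q' (drop 3 w) + (0 < q') * nb_marks q' (drop 2 w))
  else size w == 1.

Lemma nb_marksS q w :
  nb_marks q.+1 w =
  starts1324 w * (nb_marks q (drop 3 w) + (0 < q) * nb_marks q (drop 2 w)).
Proof. by []. Qed.

Lemma nb_marks_invariant q : iso_invariant (nb_marks q).
Proof.
elim: q => [|q IH] s t st /=; first by case: st => ->.
by rewrite (starts1324_invariant st) !(IH _ _ (order_iso_drop _ st)).
Qed.

(** Each occurrence starts with its smallest entry, and the next marked one starts inside it; induct
    along the chain. *)
Lemma nb_marks_min q w : 0 < nb_marks q w ->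
  0 < size w /\ forall j, 0 < j < size w -> nth 0 w 0 < nth 0 w j.
Proof.
elim: q w => [|q IH] w /=.
  rewrite lt0b => /eqP->; split=> // j; lia.
rewrite muln_gt0 lt0b => /andP[/and4P[sw h1 h2 h3]].
rewrite addn_gt0 => H; split=> [|j /andP[j0 jw]]; first by lia.
case: (ltnP j 4) => [|j4].
  by case: j j0 jw => [|[|[|[|j]]]] //= _ _ _; lia.
case/orP: H => [/IH|].
  case=> _ /(_ (j - 3)); rewrite size_drop !nth_drop addn0 subnKC; last lia.
  move=> h; have := h ltac:(lia); lia.
rewrite muln_gt0 => /andP[_ /IH[_ /(_ (j - 2))]].
rewrite size_drop !nth_drop addn0 subnKC; last lia.
move=> h; have := h ltac:(lia); lia.
Qed.

(* For [k > 0] this says that 1324 occurs at 0, 2, ..., 2k - 2. *)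
Fixpoint run (k : nat) (w : seq nat) : bool :=
  if k is k'.+1 then starts1324 w && run k' (drop 2 w)
  else (1 < size w) && (nth 0 w 0 < nth 0 w 1).

(* The order on positions generated by [run k], transitively closed. *)
Definition zigzag : rel nat :=
  fun i j => if odd i == odd j then i < j else odd j && (i <= j.+1).

Lemma runP k w :
  reflect (2 * k + 2 <= size w /\
           forall i j, i < 2 * k + 2 -> j < 2 * k + 2 -> zigzag i j ->
             nth 0 w i < nth 0 w j)
          (run k w).
Proof.
elim: k w => [|k IH] w /=.
  apply: (iffP andP) => [[sw h]|[sw H]]; last by split=> //; apply: H.
  by split=> // -[|[|i]] [|[|j]].
apply: (iffP andP) => [[/and4P[sw h1 h2 h3] /IH]|[sw H]].
  rewrite size_drop => -[sw' H]; split=> [|i j hi hj]; first by lia.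
  have {}H i' j' : i' < 2 * k + 2 -> j' < 2 * k + 2 -> zigzag i' j' ->
      nth 0 w i'.+2 < nth 0 w j'.+2.
    by move=> hi' hj' z; have := H i' j' hi' hj' z; rewrite !nth_drop.
  (* [zigzag] is invariant under shifting both positions by 2. Only comparisons involving position 0
     or 1 are new, and they pass through position 2 or 3. *)
  case: i hi => [|[|i]] hi; case: j hj => [|[|j]] hj //=.
  - by move=> _; lia.
  - case: j hj => [|j] hj _ //; apply: ltn_trans h1 _; apply: H; try lia.
    by rewrite /zigzag /=; case: odd.
  - case: j hj => [|[|j]] hj //; rewrite /zigzag /= negbK.
    case oj: (odd j) => // _; apply: ltn_trans h3 _.
    by apply: H; try lia; rewrite /zigzag /= negbK oj.
  - by rewrite /zigzag /=; case: odd.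
  - rewrite /zigzag /= negbK; case: i hi => [|[|i]] hi //=.
    by case: ifP; lia.
  - move=> z; apply: H; try lia.
    by move: z; rewrite /zigzag /= !negbK.
split.
  by rewrite /starts1324 !H //; lia.
apply/IH; rewrite size_drop; split=> [|i j hi hj z]; first by lia.
rewrite !nth_drop; apply: H; try lia.
by move: z; rewrite /zigzag /= !negbK.
Qed.

(** Position 2k + 1 holds the maximum of the run and, by [nb_marks_min], the minimum of what
    follows. Hence the 2k + 1 entries before it lie below all others, and the two parts are
    constrained separately. *)
Lemma run_nb_marks k r w :
  run k w * nb_marks r (drop (2 * k + 1) w) =
  allrel ltn (take (2 * k + 1) w) (drop (2 * k + 1) w) *
    (extends zigzag (take (2 * k + 1) w) * nb_marks r (drop (2 * k + 1) w)).
Proof.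
case: (posnP (nb_marks r (drop (2 * k + 1) w))) => [->|h]; first by rewrite !muln0.
have [] := nb_marks_min h; rewrite size_drop => sw mn.
have st : size (take (2 * k + 1) w) = 2 * k + 1 by rewrite size_takel //; lia.
rewrite mulnA mulnb; congr (nat_of_bool _ * _).
apply/runP/andP => [[_ H]|[/allrelP A /extendsP E]].
  split; last first.
    apply/extendsP => i j; rewrite st => hi hj z; rewrite !nth_take //.
    by apply: H => //; lia.
  apply/allrelP => x y /(nthP 0)[i]; rewrite st => hi; rewrite nth_take // => <-.
  move=> /(nthP 0)[j]; rewrite size_drop => hj <-.
  (* Position 2k + 1 is the greatest element of [zigzag] on the positions of the run. *)
  have lt : nth 0 w i < nth 0 (drop (2 * k + 1) w) 0.
    rewrite nth_drop; apply: H; try lia.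
    rewrite addn0 /zigzag addn1 /= mul2n odd_double /=; by case: (odd i) => /=; lia.
  case: (posnP j) => [->//|j0]; apply: ltn_trans lt _.
  by apply: mn; rewrite j0.
split=> [|i j hi hj z]; first by lia.
case: (ltnP j (2 * k + 1)) => hj'.
  have hi' : i < 2 * k + 1 by move: z; rewrite /zigzag; case: ifP; lia.
  by have := E i j; rewrite st !nth_take //; apply.
have ej : j = 2 * k + 1 by lia.
have hi' : i < 2 * k + 1 by move: z; rewrite /zigzag; case: ifP; lia.
apply: A; first by rewrite -(nth_take 0 hi') mem_nth // st.
rewrite ej; have := nth_drop (2 * k + 1) 0 w 0; rewrite addn0 => <-.
by rewrite mem_nth // size_drop.
Qed.

(** Sort the markings by the number k of occurrences before the first shift by 3, or before the end.
    The k-th one starts at 2k - 2, so the remainder starts at 2k + 1; if no mark remains, it is a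
    single entry. *)
Lemma nb_marks_runs q w : 1 < size w ->
  nb_marks q w =
  \sum_(1 <= k < q.+1) run k w * nb_marks (q - k) (drop (2 * k + 1) w).
Proof.
elim: q w => [|q IH] w sw.
  by rewrite big_geq //=; lia.
rewrite big_nat_recl // big_add1 /= subn1 /=.
case: (boolP (starts1324 w)) => [/and4P[sz h1 h2 h3]|_]; last first.
  by rewrite !mul0n big1.
(* The ascent required by [run 0] is the final step 2, 4 of the first occurrence; the term k = 1 is
   then the shift by 3. *)
have r1 : run 0 (drop 2 w).
  by rewrite /= size_drop !nth_drop addn0 addn1; apply/andP; split; lia.
rewrite /= in r1; rewrite !mul1n r1 mul1n; congr (_ + _).
case: (posnP q) => [->|q0]; first by rewrite big_geq.
rewrite mul1n IH ?size_drop; last lia.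
rewrite big_add1 /=; apply: eq_big_nat => k /andP[_ kq].
by rewrite !drop_drop; congr (_ * nb_marks _ (drop _ _)); lia.
Qed.

(** The k + 1 even positions form the first row and the k odd ones the second; [f] lists them in
    this order, and the ballot number becomes a Catalan number. *)
Lemma nb_ext_zigzag k :
  (k.+1) * nb_ext (2 * k + 1) zigzag = 'C(2 * k, k).
Proof.
pose f i := if i < k.+1 then 2 * i else 2 * (i - k.+1) + 1.
have fn i : i < 2 * k + 1 -> f i < 2 * k + 1 by rewrite /f; case: ifP; lia.
have finj i j : i < 2 * k + 1 -> j < 2 * k + 1 -> f i = f j -> i = j.
  by rewrite /f; do 2?case: ifP; lia.
rewrite -(nb_ext_reindex _ fn finj).
have := nb_two_rows (ltnSn k); rewrite subSnn mul1n /= addnn -mul2n => <-.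
congr (_ * _); have -> : k.+1 + k = 2 * k + 1 by lia.
apply: eq_nb_ext => i j hi hj; rewrite /zigzag /two_rows /f.
by case: (ltnP i k.+1) => ?; case: (ltnP j k.+1) => ?;
  rewrite !mul2n ?addn1 /= ?odd_double /=; lia.
Qed.

(** * Clusters *)

(** The conditions of [is_cluster] for the single pattern 1324, freed of the condition on the first
    position so that recursion on the positions is possible. *)
Fixpoint marking (w js : seq nat) : bool :=
  if js is a :: js' then
    occurs_at p1324 w a &&
    (if js' is b :: _ then (a < b < a + 4) && marking w js' else size w == a + 3)
  else false.

Lemma is_cluster_marking w js :
  is_cluster w (nseq (size js) p1324) js = (nth 0 js 0 == 1) && marking w js.
Proof.
have np k : k < size js -> nth [::] (nseq (size js) p1324) k = p1324.
  by move=> hk; rewrite nth_nseq hk.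
have markP : reflect [/\ 0 < size js,
    forall k, k < size js -> occurs_at p1324 w (nth 0 js k),
    forall k, k.+1 < size js -> nth 0 js k < nth 0 js k.+1 < nth 0 js k + 4
    & size w = nth 0 js (size js).-1 + 3] (marking w js).
  elim: js {np} => [|a [|b js] IH]; first by constructor; case.
    apply: (iffP andP) => [[o /eqP e]|[_ o _ e]] /=.
      by split=> // -[].
    by split; [apply: (o 0) | apply/eqP].
  apply: (iffP and3P) => [[o ab /IH[_ O S e]]|[_ O S e]].
    by split=> // -[|k] hk //; [apply: O | apply: S].
  split; [exact: (O 0) | exact: (S 0) | apply/IH; split=> // k hk].
    exact: (O k.+1).
  exact: (S k.+1).
apply/and5P/andP => [[q0 _ /forallP O /forallP S /andP[-> /eqP e]]|[-> /markP[q0 O S e]]].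
  split=> //; apply/markP; split=> // [k hk|k hk|].
  - by have := O (Ordinal hk); rewrite np.
  - by have := S (Ordinal (ltnW hk)); rewrite np ?(ltnW hk) //= hk.
  - by rewrite e np; [rewrite /=; lia | lia].
split=> //; first by rewrite size_nseq.
- by apply/forallP => k; rewrite np // O.
- by apply/forallP => k; apply/implyP => hk; rewrite np // S.
- by rewrite e np; [rewrite /=; lia | lia].
Qed.

(** Lets the positions of a marking be read back as elements of ['I_n.+1]. *)
Lemma marking_le w js : marking w js -> all (fun i => i <= size w) js.
Proof.
elim: js => // a js IH /= /andP[o m]; apply/andP; split.
  move: o; case: a {m} => // a; rewrite occurs_at1324 => /and4P[].
  by rewrite size_drop; lia.
by case: js IH m => // b js IH /andP[_ /IH].
Qed.

Fixpoint markings (w : seq nat) (q a : nat) : seq (seq nat) :=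
  if occurs_at p1324 w a then
    if q is q'.+1 then map (cons a) (markings w q' (a + 2) ++ markings w q' (a + 3))
    else if size w == a + 3 then [:: [:: a]] else [::]
  else [::].

Lemma mem_markings w q a js :
  (js \in markings w q a) = [&& size js == q.+1, head 0 js == a & marking w js].
Proof.
elim: q a js => [|q IH] a [|x js] /=.
- by case: ifP => //; case: ifP.
- case: js => [|y js] /=; last by case: ifP => //; case: ifP; rewrite //= inE eqseq_cons andbF.
  case: (eqVneq x a) => [->|ne].
    by case: occurs_at => //=; case: eqP => // _; rewrite inE eqxx.
  by case: ifP => //; case: ifP => // _ _; rewrite inE eqseq_cons (negbTE ne).
- by case: ifP => // _; apply/negP => /mapP[].
case: (eqVneq x a) => [->|ne]; last first.
  rewrite andbF; case: ifP => // _; apply/negP => /mapP[js' _ [e]].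
  by rewrite e eqxx in ne.
case: (boolP (occurs_at p1324 w a)) => o /=; last by rewrite andbF.
rewrite mem_map; last by move=> s t [].
rewrite mem_cat !IH eqSS; case: js => [|b js] //=.
rewrite !eqSS; case: (size js == q) => //=.
case m: (occurs_at p1324 w b && _); rewrite ?andbF ?andbT //.
move/andP: m => [o2 _].
(* [marking] also admits a shift by 1, which [markings] omits; [starts1324_drop1] excludes it. *)
case: (eqVneq b a.+1) => [eb|ne]; last by lia.
case: a o eb {IH} => // a o eb; move: o o2; rewrite eb !occurs_at1324.
by rewrite -add1n -drop_drop => /starts1324_drop1->.
Qed.

Lemma uniq_markings w q a : uniq (markings w q a).
Proof.
elim: q a => [|q IH] a /=; first by case: ifP => //; case: ifP.
case: ifP => // _; rewrite map_inj_uniq; last by move=> s t [].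
rewrite cat_uniq !IH andbT /=; apply/hasPn => js; rewrite /= !mem_markings.
by case/and3P=> -> /eqP-> _; rewrite /= eqn_add2l.
Qed.

Lemma size_markings w q a : size (markings w q a.+1) = nb_marks q.+1 (drop a w).
Proof.
elim: q a => [|q IH] a; rewrite /markings -/markings occurs_at1324.
  rewrite /=; case: (boolP (starts1324 _)) => //= /and4P[sz _ _ _].
  move: sz; rewrite !size_drop => sz.
  rewrite mul1n addn0; have -> : (size w - a - 3 == 1) = (size w == a.+1 + 3) by lia.
  by case: ifP.
case: ifP => o; last by rewrite /= o.
rewrite size_map size_cat !addSn !IH [RHS]nb_marksS o !mul1n.
by rewrite !drop_drop addnC [3 + a]addnC [2 + a]addnC.
Qed.

Lemma card_markings n q (w : seq nat) : size w = n ->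
  #|[set j : q.+1.-tuple 'I_n.+1 |
      is_cluster w (nseq q.+1 p1324) [seq nat_of_ord i | i <- j]]| =
  nb_marks q.+1 w.
Proof.
move=> sw; rewrite -[w in RHS]drop0 -size_markings.
set A := [set j | _]; pose f (j : q.+1.-tuple 'I_n.+1) := [seq nat_of_ord i | i <- j].
have finj : injective f by move=> s t /(inj_map val_inj)/val_inj.
rewrite cardE -(size_map f); apply: perm_size; apply: uniq_perm.
- by rewrite map_inj_uniq ?enum_uniq.
- exact: uniq_markings.
move=> js; rewrite mem_markings; apply/mapP/and3P => [[j]|[/eqP sj hd m]].
  rewrite mem_enum inE -/(f j) => h ->; have sz : size (f j) = q.+1.
    by rewrite size_map size_tuple.
  move: h; rewrite -sz is_cluster_marking nth0 => /andP[h1 h2].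
  by split=> //; rewrite sz.
have sjt : size (map (@inord n) js) == q.+1 by rewrite size_map sj.
have ejs : js = f (Tuple sjt).
  rewrite /f /= -map_comp -[LHS]map_id; apply/eq_in_map => i ij /=.
  by rewrite inordK // ltnS -sw; exact: (allP (marking_le m)).
exists (Tuple sjt) => //; rewrite mem_enum inE -/(f _) -ejs -sj.
by rewrite is_cluster_marking nth0 hd m.
Qed.

Lemma nb_clusters1324 n q :
  nb_clusters [:: p1324] n q.+1 = \sum_(s : 'S_n) nb_marks q.+1 (word s).
Proof.
have valE (ps : q.+1.-tuple (seq_sub [:: p1324])) :
    [seq val p | p <- ps] = nseq q.+1 p1324.
  have sz : size [seq val p | p <- ps] = q.+1 by rewrite size_map size_tuple.
  rewrite -[X in nseq X]sz; apply/all_pred1P/allP.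
  by move=> _ /mapP[p _ ->]; have := valP p; rewrite inE.
rewrite /nb_clusters -sum1dep_card big_mkcond /=.
pose F (s : 'S_n) (ps : q.+1.-tuple (seq_sub [:: p1324]))
    (j : q.+1.-tuple 'I_n.+1) :=
  if is_cluster (word s) [seq val p | p <- ps] [seq nat_of_ord i | i <- j]
  then 1 else 0.
rewrite -(pair_bigA _ (fun x j => F x.1 x.2 j)) /=.
rewrite -(pair_bigA _ (fun s ps => \sum_j F s ps j)) /= /F.
apply: eq_bigr => s _; under eq_bigr => ps _.
  rewrite -big_mkcond valE sum1dep_card card_markings ?size_word //.
  over.
(* With one pattern available there is exactly one tuple of patterns. *)
by rewrite sum_nat_const card_tuple card_seq_sub // exp1n mul1n.
Qed.

(** The base case of [nb_marks] absorbs the conventions for n = 1 and for l = 0, so later sums need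
    no case distinction. *)
Lemma cE n q : c n q%:Z = \sum_(s : 'S_n) nb_marks q (word s).
Proof.
rewrite /c; case: eqP => [->|ne].
  rewrite (eq_bigr (fun=> nat_of_bool (q == 0))) => [|s _].
    by rewrite sum_nat_const card_Sn mul1n.
  case: q => [|q] /=; first by rewrite size_word.
  by rewrite /starts1324 size_word.
case: q => [|q]; last exact: nb_clusters1324.
by rewrite big1 // => s _; rewrite /= size_word; case: eqP.
Qed.

Lemma c_neg n q : c n (Negz q) = 0.
Proof. by rewrite /c; case: ifP. Qed.

(** Sum [nb_marks_runs] over all permutations; [run_nb_marks] puts each term in the form that
    [sum_below_split_perm] factors. *)
Lemma c_recursion n q : 1 < n ->
  c n q%:Z = \sum_(1 <= k < q.+1 | 2 * k + 2 <= n)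
    nb_ext (2 * k + 1) zigzag * c (n - 2 * k - 1) (q - k)%:Z.
Proof.
move=> n1; rewrite cE.
have sz (s : 'S_n) : 1 < size (word s) by rewrite size_word.
rewrite (eq_bigr _ (fun s _ => nb_marks_runs q (sz s))).
rewrite exchange_big /= [RHS]big_mkcond; apply: eq_bigr => k _.
case: ifP => hk; last first.
  by rewrite big1 // => s _; case: runP => //; rewrite size_word hk; case.
under eq_bigr => s _ do rewrite run_nb_marks.
rewrite cE; have -> : n - 2 * k - 1 = n - (2 * k + 1) by lia.
have -> : n = (2 * k + 1) + (n - (2 * k + 1)) by lia.
rewrite addKn /nb_ext.
rewrite -(sum_below_split_perm _ _ (F := fun w => nat_of_bool (extends zigzag w))
  (G := nb_marks (q - k))) //; last exact: nb_marks_invariant.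
by move=> s t /extends_invariant->.
Qed.

(** * Generating function *)

Lemma nb_occ1324 w :
  nb_occ p1324 w = count (fun i => starts1324 (drop i w)) (iota 0 (size w)).
Proof.
rewrite /nb_occ -[1]addn0 iotaDl count_map; apply: eq_count => i /=.
by rewrite add1n occurs_at1324.
Qed.

Lemma nb_occ_invariant : iso_invariant (nb_occ p1324).
Proof.
move=> s t st; rewrite !nb_occ1324; case: (st) => <- _; apply: eq_count => i.
exact: starts1324_invariant (order_iso_drop _ st).
Qed.

Lemma nb_occ_drop d w :
  nb_occ p1324 (drop d w) = starts1324 (drop d w) + nb_occ p1324 (drop d.+1 w).
Proof.
rewrite -add1n -drop_drop; case: (drop d w) => [//|x v] {d w}.
rewrite [LHS]nb_occ1324 /= drop0 nb_occ1324 -[1]addn0 iotaDl count_map.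
by congr (_ + _); apply: eq_count.
Qed.

Lemma starts1324_take m w : starts1324 (take m w) = (3 < m) && starts1324 w.
Proof.
rewrite /starts1324 size_take_min leq_min; case: ltnP => //= hm.
by rewrite !nth_take //; lia.
Qed.

Section ClusterExpansion.
Local Open Scope ring_scope.
Variables (A : comNzRingType) (t : A).

Let u : A := t - 1.

Definition occ_weight (w : seq nat) : A := t ^+ nb_occ p1324 w.

(** Clusters filling the whole of [w], weighted by u per mark; the truncation at N marks keeps the
    sum finite. *)
Definition cluster_weight (N : nat) (w : seq nat) : A :=
  \sum_(0 <= q < N) (nb_marks q.+1 w)%:R * u ^+ q.+1.

Definition convolve (H : seq nat -> A) (w : seq nat) : A :=
  \sum_(0 <= m < (size w).+1) H (take m w) * occ_weight (drop m w).

(** For a boolean b, t ^ b = 1 + b * u: an occurrence is left unmarked or marked. *)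
Lemma occ_weight_drop d w : occ_weight (drop d w) =
  (1 + (starts1324 (drop d w))%:R * u) * occ_weight (drop d.+1 w).
Proof.
rewrite /occ_weight nb_occ_drop exprD /u; case: starts1324 => /=.
  by rewrite expr1; ring.
by rewrite expr0; ring.
Qed.

(** Cutting [w] at m is cutting [drop d w] at m - d. Cuts with m < 4 vanish on both sides: the
    prefix is too short for 1324, and [H] is zero on what it leaves. *)
Lemma convolve_shift d (H : seq nat -> A) w : (d <= 3)%N ->
  (forall v, (size v < 4 - d)%N -> H v = 0) ->
  convolve (fun v => (starts1324 v)%:R * H (drop d v)) w =
  (starts1324 w)%:R * convolve H (drop d w).
Proof.
move=> d3 H0; rewrite /convolve.
case: (boolP (starts1324 w)) => sw; last first.
  by rewrite mul0r big1 // => m _; rewrite starts1324_take (negbTE sw) andbF !mul0r.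
have szw : (3 < size w)%N by case/and4P: sw.
rewrite mul1r (@big_cat_nat _ _ _ d) //=; last by lia.
rewrite big_nat big1 => [|m /andP[_ md]]; last first.
  have m3 : (3 < m)%N = false by lia.
  by rewrite starts1324_take m3 !mul0r.
rewrite add0r -{1}[d]add0n big_addn size_drop subSn; last by lia.
apply: eq_bigr => m _.
rewrite starts1324_take sw andbT take_drop drop_drop.
case: ltnP => hm; first by rewrite mul1r.
by rewrite -take_drop H0 ?(mul0r, mulr0) // size_take_min; lia.
Qed.

Lemma convolveD (H1 H2 : seq nat -> A) w :
  convolve (fun v => H1 v + H2 v) w = convolve H1 w + convolve H2 w.
Proof. by rewrite /convolve -big_split; apply: eq_bigr => m _; rewrite mulrDl. Qed.

Lemma convolveZ a (H : seq nat -> A) w :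
  convolve (fun v => a * H v) w = a * convolve H w.
Proof. by rewrite /convolve big_distrr /=; apply: eq_bigr => m _; rewrite mulrA. Qed.

Lemma eq_convolve (H1 H2 : seq nat -> A) w :
  H1 =1 H2 -> convolve H1 w = convolve H2 w.
Proof. by move=> e; apply: eq_bigr => m _; rewrite e. Qed.

Lemma convolve_size1 w :
  convolve (fun v => (size v == 1)%N%:R) w = (0 < size w)%N%:R * occ_weight (drop 1 w).
Proof.
rewrite /convolve big_nat_recl // take0 /= mul0r add0r.
case: w => [|x w]; first by rewrite big_geq ?mul0r.
rewrite [size _]/= big_nat_recl // big_nat big1 => [|m /andP[_ hm]]; last first.
  by rewrite size_takel //= mul0r.
by rewrite addr0 /= take0 mul1r.
Qed.

Lemma cluster_weightS N w : cluster_weight N.+1 w =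
  u * ((starts1324 w)%:R * (size (drop 3 w) == 1)%N%:R +
       ((starts1324 w)%:R * cluster_weight N (drop 3 w) +
        (starts1324 w)%:R * cluster_weight N (drop 2 w))).
Proof.
rewrite -!mulrDr mulrCA.
rewrite /cluster_weight.
under eq_bigr => q _ do rewrite nb_marksS natrM -mulrA exprS.
rewrite -big_distrr; congr (_ * _); rewrite big_nat_recl //=.
rewrite addn0 expr0 mulr1 [RHS]mulrDr; congr (_ + _); first by rewrite mulrC.
rewrite -big_split big_distrr; apply: eq_bigr => q _ /=.
by rewrite mul1n natrD !exprS; ring.
Qed.

(** Choosing an initial cluster and weighting the rest freely amounts to marking the occurrence at
    the start and weighting everything after the first position freely. The induction follows the
    second mark of the cluster. *)
Lemma convolve_cluster_weight N w : (size w <= N)%N ->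
  convolve (cluster_weight N) w =
  (starts1324 w)%:R * u * occ_weight (drop 1 w).
Proof.
elim: N w => [|N IH] w szN.
  have -> : w = [::] by case: w szN.
  by rewrite !mul0r /convolve big1 // => m _; rewrite /cluster_weight big_geq ?mul0r.
have cw0 M v : (size v < 4)%N -> cluster_weight M v = 0.
  move=> sv; rewrite /cluster_weight big1 // => q _.
  by rewrite nb_marksS /starts1324 ltnNge -ltnS sv mul0r.
rewrite (eq_convolve _ (cluster_weightS N)) convolveZ !convolveD.
rewrite (@convolve_shift 3 (fun v => (size v == 1)%N%:R)) //; last first.
  by case.
rewrite !convolve_shift //; try by move=> v sv; apply: cw0; lia.
case: (boolP (starts1324 w)) => [sw|_]; last by rewrite !mul0r !addr0 mulr0.
have szw : (3 < size w)%N by case/and4P: sw.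
rewrite !IH ?size_drop; try lia.
rewrite convolve_size1 size_drop subn_gt0 szw !drop_drop !mul1r.
(* Expanding at shifts 1, 2 and 3 produces the same three cases: next mark at 2, next mark at 3, or
   none; shift 1 contributes nothing. *)
rewrite (occ_weight_drop 1) (starts1324_drop1 sw) (occ_weight_drop 2).
by rewrite (occ_weight_drop 3) mul0r; ring.
Qed.

(** The first position is either an isolated entry, the term q = 0, or opens a cluster. *)
Lemma occ_weight_convolve N w : (0 < size w <= N)%N ->
  occ_weight w =
  convolve (fun v => \sum_(0 <= q < N.+1) (nb_marks q v)%:R * u ^+ q) w.
Proof.
case/andP=> w0 wN.
have e v : \sum_(0 <= q < N.+1) (nb_marks q v)%:R * u ^+ q =
    (size v == 1)%N%:R + cluster_weight N v.
  by rewrite big_nat_recl //= expr0 mulr1.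
rewrite (eq_convolve _ e) convolveD convolve_size1 convolve_cluster_weight //.
by rewrite w0 -{1}[w]drop0 occ_weight_drop drop0 mulrDl !mul1r.
Qed.

Lemma sum_occ_weight n N : (0 < n <= N)%N ->
  \sum_(s : 'S_n) occ_weight (word s) =
  \sum_(1 <= m < n.+1) 'C(n, m)%:R *
    ((\sum_(0 <= q < N.+1) (c m q%:Z)%:R * u ^+ q) *
     (\sum_(s : 'S_(n - m)) occ_weight (word s))).
Proof.
move=> nN; under eq_bigr => s _.
  rewrite (@occ_weight_convolve N) ?size_word // /convolve size_word.
  over.
(* The empty prefix carries neither a single entry nor a cluster. *)
rewrite exchange_big /= big_nat_recl // big1 ?add0r => [|s _]; last first.
  rewrite take0 big1 ?mul0r // => -[|q] _ /=; by rewrite mul0r.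
rewrite big_add1 /=; apply: eq_big_nat => m /andP[_ mn].
have := @sum_split_perm A m.+1 (n - m.+1)
  (fun v => \sum_(0 <= q < N.+1) (nb_marks q v)%:R * u ^+ q) occ_weight.
rewrite subnKC // => ->.
- rewrite exchange_big /=; congr (_ * (_ * _)).
  by apply: eq_bigr => q _; rewrite cE natr_sum big_distrl.
- by move=> v w vw; apply: eq_bigr => q _; rewrite (nb_marks_invariant q vw).
- by move=> v w vw; rewrite /occ_weight (nb_occ_invariant vw).
Qed.

End ClusterExpansion.

(** * Coefficients in Q[t][[x]] *)

Lemma Pi_seriesE n :
  Pi_series n = ((n`!%:R)^-1 *: \sum_(s : 'S_n) occ_weight 'X (word s))%R.
Proof.
rewrite /Pi_series.
rewrite (eq_bigr (fun k => (n`!%:R)^-1 *: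
  (\sum_(s : 'S_n | nb_occ p1324 (word s) == k) 'X^k)))%R; last first.
  move=> k _; rewrite sumr_const -scaler_nat scalerA mulrC; congr (_ * _%:R *: _)%R.
  by apply: eq_card => s; rewrite !inE.
rewrite -scaler_sumr big_mkord; congr (_ *: _)%R.
have lt (s : 'S_n) : nb_occ p1324 (word s) < n.+1.
  rewrite ltnS -[X in _ <= X](size_word s) -[X in _ <= X](size_iota 1).
  exact: count_size.
rewrite [RHS](partition_big (fun s => Ordinal (lt s)) xpredT) //=.
by apply: eq_bigr => k _; apply: eq_bigr => s /eqP <-.
Qed.

(** Starting at q = 0 makes the value at m = 1 equal to 1, so the term x and the cluster series are
    handled uniformly. *)
Definition c_poly (N m : nat) : {poly rat} :=
  (\sum_(0 <= q < N.+1) (c m q%:Z)%:R * ('X - 1) ^+ q)%R.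

Lemma c_poly1 N : c_poly N 1 = 1%R.
Proof.
rewrite /c_poly big_nat_recl // big1 ?addr0 ?mulr1 // => q _.
by rewrite mul0r.
Qed.

Lemma cluster_seriesE N m : 1 < m <= N ->
  cluster_series m = ((m`!%:R)^-1 *: c_poly N m)%R.
Proof.
case/andP=> m1 mN; rewrite /cluster_series m1 /c_poly.
have c0 : c m 0%:Z = 0 by rewrite /c; case: eqP m1 => [->|].
rewrite [in RHS]big_ltn // c0 mul0r add0r.
rewrite [in RHS](@big_cat_nat _ _ _ m.+1) //=.
rewrite [X in (_ *: (_ + X))%R]big_nat [X in (_ *: (_ + X))%R]big1 => [|q /andP[mq _]];
  last first.
  by rewrite c_eq0 // mul0r.
rewrite addr0 scaler_sumr; apply: eq_bigr => q _.
by rewrite mulrC -scalerA scaler_nat mulr_natl.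
Qed.

Lemma c_eq0_small n l : 1 < n < 4 -> c n l = 0.
Proof.
move=> hn; case: l => [q|q]; last exact: c_neg.
rewrite cE big1 // => s _; case: q => [|q] /=; first by rewrite size_word; lia.
have n3 : (3 < n) = false by lia.
by rewrite /starts1324 size_word n3.
Qed.

Local Open Scope ring_scope.

Lemma c_recursion_rat (n : nat) (l : int) : (4 <= n)%N ->
  (c n l)%:R =
    \sum_(1 <= k < n | (2 * k + 2 <= n)%N)
       (k.+1%:R)^-1 * 'C(2 * k, k)%:R * (c (n - 2 * k - 1) (l - k%:Z))%:R :> rat.
Proof.
move=> n4; case: l => [q|q]; last first.
  rewrite c_neg big1 // => k _.
  have -> : Negz q - k%:Z = Negz (q + k) by lia.
  by rewrite c_neg mulr0.
pose F k : rat := (2 * k + 2 <= n)%N%:R *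
  ((k.+1%:R)^-1 * 'C(2 * k, k)%:R * (c (n - 2 * k - 1) (q%:Z - k%:Z))%:R).
(* Terms with k >= n violate the side condition; those with k > q have a negative second index.
   Hence the ranges k <= q and k < n give the same sum, compared through the common bound q + 1 +
   n. *)
have F0 k : (n <= k)%N || (q < k)%N -> F k = 0.
  rewrite /F; case/orP=> h.
    have -> : (2 * k + 2 <= n)%N = false by lia.
    by rewrite mul0r.
  have -> : q%:Z - k%:Z = Negz (k - q).-1 by lia.
  by rewrite c_neg !mulr0.
have widen a b : (0 < a <= b)%N -> (forall k, (a <= k)%N -> F k = 0) ->
    \sum_(1 <= k < a) F k = \sum_(1 <= k < b) F k.
  case/andP=> a0 ab Fa; rewrite [RHS](@big_cat_nat _ _ _ a) //=.
  by rewrite [X in _ = _ + X]big_nat [X in _ = _ + X]big1 ?addr0 // => k /andP[/Fa].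
transitivity (\sum_(1 <= k < q.+1) F k).
  rewrite c_recursion; last by lia.
  rewrite natr_sum big_mkcond; apply: eq_big_nat => k /andP[_ kq].
  rewrite /F; case: ifP => _; last by rewrite mul0r.
  rewrite mul1r natrM -nb_ext_zigzag natrM mulrA mulVf ?mul1r ?pnatr_eq0 //.
  by rewrite subzn.
rewrite (@widen q.+1 (q.+1 + n)%N) ?leq_addr //; last first.
  by move=> k h; apply: F0; rewrite h orbT.
rewrite -(@widen n) ?leq_addl //; last 2 first.
- by lia.
- by move=> k h; apply: F0; rewrite h.
rewrite [RHS]big_mkcond; apply: eq_bigr => k _; rewrite /F.
by case: ifP => _; rewrite ?mul1r ?mul0r.
Qed.

Lemma Pi_series_inverse :
  fps_is_inverse Pi_series
    (fps_sub (fps_sub (fps_one {poly rat}) (fps_X {poly rat})) cluster_series).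
Proof.
case=> [|n]; rewrite /fps_mul.
  rewrite big_ord_recl big_ord0 addr0 /fps_sub /fps_one /fps_X /cluster_series /=.
  rewrite !subr0 mul1r Pi_seriesE fact0 invr1 scale1r.
  rewrite (eq_bigr (fun=> 1)) => [|s _]; last first.
    by rewrite /occ_weight; have /size0nil-> := size_word s.
  by rewrite sumr_const card_Sn.
rewrite -(big_mkord xpredT (fun i => fps_sub (fps_sub (fps_one _) (fps_X _))
   cluster_series i * Pi_series (n.+1 - i)%N)).
rewrite big_nat_recl // {1}/fps_sub {1}/fps_sub /fps_one /fps_X /cluster_series.
rewrite -/cluster_series /= !subr0 mul1r subn0.
(* The term of index 0 is the coefficient of [Pi_series] itself; its expansion cancels the remaining
   terms one by one. *)
rewrite [X in X + _]Pi_seriesE (@sum_occ_weight _ _ n.+1 n.+1) ?leqnn //.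
rewrite big_add1 /= scaler_sumr -big_split big_nat big1 // => m /andP[_ mn] /=.
rewrite -/(c_poly n.+1 m.+1) Pi_seriesE.
have -> : fps_sub (fps_sub (fps_one _) (fps_X _)) cluster_series m.+1 =
    - ((m.+1`!%:R)^-1 *: c_poly n.+1 m.+1).
  rewrite /fps_sub /fps_one /fps_X; case: m mn => [|m] mn /=.
    by rewrite c_poly1 /cluster_series /= invr1 scale1r sub0r subr0.
  by rewrite (@cluster_seriesE n.+1) // !sub0r oppr0 sub0r.
rewrite mulNr -scalerAl -scalerAr scalerA mulr_natl -scaler_nat scalerA.
rewrite -scalerBl; set a := (_ - _); suff -> : a = 0 by rewrite scale0r.
(* Dividing the binomial by (n + 1)! leaves the two inverse factorials of the product of exponential
   series. *)
rewrite /a -(bin_fact mn) !natrM !invfM.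
have hb : 'C(n.+1, m.+1)%:R != 0 :> rat by rewrite pnatr_eq0 -lt0n bin_gt0.
by rewrite mulrAC mulVf // mul1r subrr.
Qed.

Theorem theorem1324 :
  [/\ forall l : int, c 2 l = 0%N /\ c 3 l = 0%N,
      forall (n : nat) (l : int), (4 <= n)%N ->
        (c n l)%:R =
          \sum_(1 <= k < n | (2 * k + 2 <= n)%N)
             (k.+1%:R)^-1 * 'C(2 * k, k)%:R * (c (n - 2 * k - 1) (l - k%:Z))%:R
          :> rat
    & fps_is_inverse Pi_series
        (fps_sub (fps_sub (fps_one {poly rat}) (fps_X {poly rat}))
                 cluster_series) ].
Proof.
split; first by move=> l; rewrite !c_eq0_small.
  exact: c_recursion_rat.
exact: Pi_series_inverse.
Qed.
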